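(* Let $\mathbf{L}\in\mathbb{R}^{N\times N}$ be a symmetric matrix, let $\mathbf{M}\in\mathbb{R}^{N\times N}$ be a distribution matrix, and suppose that the lower triangular part (including the diagonal) $\mathbf{\tilde G}$ of $\mathbf{L}\mathbf{M}$ is invertible. For each $\mathbf{b}\in\mathbb{R}^N$, let $\mathbf{x}^{(k)}$, $k\ge 0$, be the iterates of the symmetric distributive Gauss-Seidel (DGS) smoother applied to $\mathbf{L}\mathbf{x}=\mathbf{b}$ with initial guess $\mathbf{x}^{(0)}=\mathbf{0}$. Then for every integer $n\ge 1$ there is a symmetric matrix $\mathbf{C}\in\mathbb{R}^{N\times N}$, independent of $\mathbf{b}$, such that $\mathbf{x}^{(n)}=\mathbf{C}\mathbf{b}$ for all $\mathbf{b}\in\mathbb{R}^N$.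
   Context: A distributive smoother for $\mathbf{L}\mathbf{x}=\mathbf{b}$ is obtained from relaxation on the right-preconditioned system $\mathbf{L}\mathbf{M}\mathbf{y}=\mathbf{b}$, $\mathbf{x}=\mathbf{M}\mathbf{y}$, where the square matrix $\mathbf{M}$ is called the distribution matrix. (For the discrete Stokes system $\mathbf{L}=\begin{pmatrix}\mathbf{A}&\mathbf{B}^T\\ \mathbf{B}&\mathbf{0}\end{pmatrix}$ with viscosity $\eta$ one uses $\mathbf{M}=\begin{pmatrix}\mathbf{I}&-\mathbf{B}^T\\ \mathbf{0}&\eta\mathbf{B}\mathbf{B}^T\end{pmatrix}$.) Write $\mathbf{L}\mathbf{M}=\mathbf{\tilde G}+\mathbf{\tilde H}$, with $\mathbf{\tilde G}$ lower triangular (including the diagonal) and $\mathbf{\tilde H}$ strictly upper triangular. One step of the symmetric DGS smoother is $$\mathbf{x}^{(k+\frac12)}=\mathbf{x}^{(k)}+\mathbf{M}\mathbf{\tilde G}^{-1}(\mathbf{b}-\mathbf{L}\mathbf{x}^{(k)}),$$ $$\mathbf{x}^{(k+1)}=\mathbf{x}^{(k+\frac12)}+\mathbf{\tilde G}^{-T}\mathbf{M}^{T}(\mathbf{b}-\mathbf{L}\mathbf{x}^{(k+\frac12)}),$$ where $\mathbf{\tilde G}^{-T}=(\mathbf{\tilde G}^{-1})^T$. *)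

(* Defs.v *)
From HB Require Import structures.
From mathcomp Require Import all_boot all_order all_algebra.
From mathcomp Require Import reals.

Set Implicit Arguments.
Unset Strict Implicit.
Unset Printing Implicit Defensive.

Import GRing.Theory.
Local Open Scope ring_scope.

Definition lower_part (R : realType) (N : nat) (A : 'M[R]_N) : 'M[R]_N :=
  \matrix_(i, j) (if (j <= i)%N then A i j else 0).

(* The factor G~ of the splitting L M = G~ + H~; the remainder H~ is then
   strictly upper triangular. *)
Definition dgs_lower (R : realType) (N : nat) (L M : 'M[R]_N) : 'M[R]_N :=
  lower_part (L *m M).

Definition dgs_forward (R : realType) (N : nat) (L M : 'M[R]_N)
    (b x : 'cV[R]_N) : 'cV[R]_N :=
  x + M *m invmx (dgs_lower L M) *m (b - L *m x).

Definition dgs_backward (R : realType) (N : nat) (L M : 'M[R]_N)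
    (b x : 'cV[R]_N) : 'cV[R]_N :=
  x + (invmx (dgs_lower L M))^T *m M^T *m (b - L *m x).

Definition sdgs_step (R : realType) (N : nat) (L M : 'M[R]_N)
    (b x : 'cV[R]_N) : 'cV[R]_N :=
  dgs_backward L M b (dgs_forward L M b x).

Definition sdgs_iterate (R : realType) (N : nat) (L M : 'M[R]_N)
    (b x0 : 'cV[R]_N) (k : nat) : 'cV[R]_N :=
  iter k (sdgs_step L M b) x0.

(* Main.v *)
Require Import Defs.
From HB Require Import structures.
From mathcomp Require Import all_boot all_order all_algebra.
From mathcomp Require Import reals.

(* With P = M G~^-1, the two half steps combine into x + S (b - L x), where
   S = P + P^T - P^T L P is symmetric. Started from 0, such an iteration yields
   x^(n) = C_n b with C_(n+1) = C_n + S - S L C_n, and C_n is a polynomial in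
   S L applied to S; hence C_n L S = S L C_n, which keeps C_n symmetric. *)

Import GRing.Theory.
Local Open Scope ring_scope.

(** The formula is read off from composing the two half steps: [1 - S L = (1 - P^T L)(1 - P L)]. *)
Definition sdgs_precond {R : realType} {N : nat} (L M : 'M[R]_N) : 'M[R]_N :=
  let P := M *m invmx (dgs_lower L M) in P + P^T - P^T *m L *m P.

Lemma sdgs_precond_sym {R : realType} {N : nat} (L M : 'M[R]_N) :
  L^T = L -> (sdgs_precond L M)^T = sdgs_precond L M.
Proof.
move=> L_sym; rewrite /sdgs_precond; move: (M *m _) => P.
by rewrite !linearD linearN /= !trmx_mul !trmxK L_sym mulmxA [P^T + P]addrC.
Qed.

Lemma sdgs_stepE {R : realType} {N : nat} (L M : 'M[R]_N) (b x : 'cV[R]_N) :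
  sdgs_step L M b x = x + sdgs_precond L M *m (b - L *m x).
Proof.
rewrite /sdgs_step /dgs_backward /dgs_forward /sdgs_precond -trmx_mul.
(* With [r = b - L x], the residual left by the forward half step is [r - L P r]. *)
move: (M *m invmx _) => P; rewrite [L *m (x + _)]mulmxDr opprD [b + (_ - _)]addrA.
move: (b - L *m x) => r.
by rewrite mulmxBr mulmxBl mulmxDl !mulmxA !addrA.
Qed.

Lemma richardson_iter_sym {R : comPzRingType} {N : nat} (L S : 'M[R]_N)
    (n : nat) :
  L^T = L -> S^T = S ->
  exists C : 'M[R]_N,
    C^T = C /\
    forall b : 'cV[R]_N, iter n (fun x => x + S *m (b - L *m x)) 0 = C *m b.
Proof.
move=> L_sym S_sym.
(* The induction must carry the commutation as well: [S L C] has transpose [C L S]. *)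
suff [C [CT _ CE]] : exists C : 'M[R]_N,
    [/\ C^T = C, C *m L *m S = S *m L *m C &
    forall b : 'cV[R]_N, iter n (fun x => x + S *m (b - L *m x)) 0 = C *m b].
  by exists C.
elim: n => [|n [C [CT comm CE]]].
  by exists 0; split=> [||b]; rewrite ?trmx0 ?mul0mx ?mulmx0.
exists (C + S - S *m L *m C); split=> [||b].
- by rewrite !linearD linearN /= !trmx_mul CT L_sym S_sym mulmxA comm.
- rewrite !mulmxDl !mulmxDr !mulNmx !mulmxN comm.
  (* Only [S L C L S = S L S L C] remains; regrouping exposes the inner [C L S], where [comm]
     applies again. *)
  by rewrite -[S *m L *m C *m L *m S]mulmxA -[S *m L *m C *m _]mulmxA
    [C *m (L *m S)]mulmxA comm.
- by rewrite iterS CE mulmxBr mulmxBl mulmxDl !mulmxA addrA.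
Qed.

Theorem theorem1 (R : realType) (N : nat) (L M : 'M[R]_N)
    (L_sym : L^T = L)
    (G_inv : dgs_lower L M \in unitmx)
    (n : nat) (n_ge1 : (1 <= n)%N) :
  exists C : 'M[R]_N,
    C^T = C /\ forall b : 'cV[R]_N, sdgs_iterate L M b 0 n = C *m b.
Proof.
have [C [CT CE]] :=
  richardson_iter_sym _ _ n L_sym (sdgs_precond_sym L M L_sym).
exists C; split=> // b; rewrite -CE /sdgs_iterate.
by apply: eq_iter => x; exact: sdgs_stepE.
Qed.
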